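(* Suppose that $n=2^k+1$ for some integer $k\geq 1$. Given any subspaces $W_1,\ldots,W_m$ of $\mathbb{R}^n$ with $m<2n-1$, there exist $x,y\in\mathbb{R}^n$ with $x\neq\pm y$ such that $\|P_jx\|=\|P_jy\|$ for all $j=1,\ldots,m$, where $P_j:\mathbb{R}^n\to W_j$ denotes the orthogonal projection onto $W_j$.
   Context: $\|\cdot\|$ is the Euclidean norm on $\mathbb{R}^n$. ''$x\neq\pm y$'' means $x\neq y$ and $x\neq -y$. *)

(* Defs.v *)
From HB Require Import structures.
From mathcomp Require Import all_boot all_order all_algebra.
From mathcomp Require Import reals.

Set Implicit Arguments.
Unset Strict Implicit.
Unset Printing Implicit Defensive.

Import Order.TTheory GRing.Theory Num.Theory.
Local Open Scope ring_scope.

Section Euclidean.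
Variables (R : rcfType) (n : nat).
Implicit Types (x y : 'rV[R]_n) (W : {vspace 'rV[R]_n}).

Definition dotv x y : R := \sum_(i < n) x 0 i * y 0 i.

Fact dotv_bilinear :
  bilinear_for (GRing.Scale.Law.clone _ _ ( *%R ) _)
    (GRing.Scale.Law.clone _ _ (idfun \; *%R ) _) dotv.
Proof.
split=> [v|v] a x y /=; rewrite /dotv mulr_sumr -big_split /=.
- by apply: eq_bigr => i _; rewrite !mxE mulrDl mulrA.
- by apply: eq_bigr => i _; rewrite !mxE mulrDr mulrCA.
Qed.

HB.instance Definition _ :=
  bilinear_isBilinear.Build R 'rV[R]_n 'rV[R]_n R
    (GRing.Scale.Law.clone _ _ ( *%R ) _)
    (GRing.Scale.Law.clone _ _ (idfun \; *%R ) _) dotv dotv_bilinear.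

Fact dotv_sym x y : dotv x y = (-1) ^+ false * idfun (dotv y x).
Proof. by rewrite mul1r /=; apply: eq_bigr => i _; rewrite mulrC. Qed.

HB.instance Definition _ :=
  @isHermitianSesquilinear.Build R 'rV[R]_n false idfun dotv dotv_sym.

Fact dotv_gt0 x : x != 0 -> 0 < dotv x x.
Proof.
move=> x0; rewrite lt0r sumr_ge0 ?andbT => [|i _]; last first.
  by rewrite -expr2 sqr_ge0.
apply: contra x0; rewrite psumr_eq0 => [/allP x0|i _]; last first.
  by rewrite -expr2 sqr_ge0.
apply/eqP/rowP => i; rewrite mxE; apply/eqP.
by have := x0 i (mem_index_enum _); rewrite mulf_eq0 orbb.
Qed.

HB.instance Definition _ := isDotProduct.Build R 'rV[R]_n dotv dotv_gt0.

(* The library norm `|x| on row vectors (matrix_normedtype) is the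
   supremum norm, so the Euclidean norm is introduced separately. *)
Definition enorm x : R := Num.sqrt (dotv x x).

(* W^perp for the standard dot product *)
Definition operp W : {vspace 'rV[R]_n} := orthov dotv W.

Lemma mem_operpP W x :
  reflect {in W, forall w, dotv x w = 0} (x \in operp W).
Proof. exact: mem_orthovP. Qed.

Lemma cap_operp W : (W :&: operp W = 0)%VS.
Proof.
apply/eqP; rewrite -subv0; apply/subvP => x /[!memv_cap] /andP[xW].
move/mem_operpP => /(_ x xW) xx0; rewrite memv0.
by apply/negPn/negP => /dotv_gt0; rewrite xx0 ltxx.
Qed.

Lemma add_operp W : (W + operp W = fullv)%VS.
Proof.
suff dimP (s : seq 'rV[R]_n) :
    (\dim {:'rV[R]_n} <= size s + \dim (operp <<s>>))%N.
  apply/eqP; rewrite eqEdim subvf dimv_disjoint_sum ?cap_operp //=.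
  by have := dimP (vbasis W); rewrite size_tuple (span_basis (vbasisP W)).
elim: s => [|w s IHs] /=; first by rewrite span_nil /operp orthov0.
rewrite /operp span_cons addvC.
have -> : orthov dotv (<<s>> + <[w]>)%VS
          = (orthov dotv <<s>> :&: orthov dotv <[w]>)%VS.
  apply/eqP; rewrite eqEsubv subv_cap -orthovD subvv /=.
  by rewrite orthovD -subv_cap subvv.
apply: leq_trans IHs _; rewrite addSnnS leq_add2l -ltnS.
have := leq_dim_orthov1 (dotv : {dot _ for _}) w (orthov dotv <<s>>)%VS.
by case: (\dim (orthov _ <<s>>)%VS).
Qed.

(* Projection onto W along its orthogonal complement; since
   W (+) W^perp = R^n (cap_operp, add_operp), this is the orthogonal
   projection onto W, as oproj_mem and oproj_perp confirm. *)
Definition oproj W : 'End('rV[R]_n) := daddv_pi W (operp W).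

Lemma oproj_mem W x : oproj W x \in W.
Proof. exact: memv_pi. Qed.

Lemma oproj_perp W x : x - oproj W x \in operp W.
Proof.
have /(daddv_pi_add (cap_operp W)) {1}<- : x \in (W + operp W)%VS.
  by rewrite add_operp memvf.
by rewrite addrAC subrr add0r memv_pi.
Qed.

End Euclidean.

(* Main.v *)
Require Import Defs.
From mathcomp Require Import all_boot all_order all_algebra.
From mathcomp Require Import reals ring lra.
From mathcomp Require mpoly polyrcf.
From mathcomp Require boolp classical_sets functions topology normedtype derive.

Set Implicit Arguments.
Unset Strict Implicit.
Unset Printing Implicit Defensive.

Import Order.TTheory GRing.Theory Num.Theory.
Local Open Scope ring_scope.

(** Put q = n - 1 and B_j(u, v) = <P_j u, P_j v>, a positive semidefinite
    symmetric bilinear form.  With x = u + v and y = u - v the equality of the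
    norms becomes B_j(u, v) = 0, so a real zero (u, v) of all the B_j with
    u, v <> 0 is wanted.  A complex zero of the form (a + i b, a - i b) is as
    good: it says B_j(a, a) + B_j(b, b) = 0, hence P_j a = P_j b = 0, and one
    of a, b can be paired with 0.  So it suffices to find an unordered pair
    {u, v} that complex conjugation maps to itself.  In general position, 2q
    symmetric bilinear forms vanish at 'C(2q, q) / 2 unordered pairs of points
    of the complex projective space of dimension q; this number is odd because
    q is a power of 2 (odd_bin_central), and a conjugation on an odd number of
    pairs fixes one of them.

    The count is made algebraic by a deformation.  Let E_k(u, v) be the
    coefficient of z^k in the product of the polynomials with coefficient
    vectors u and v, and normalise u and v to have last coordinate 1, that is,
    to be monic of degree q.  The equations E_k(u, v) = t_k for k < 2q ask for
    the factorisations of a monic polynomial of degree 2q into two monic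
    factors of degree q, and there are 'C(2q, q) of them.  The difference
    theta = u_(q-1) - v_(q-1) separates these factorisations, so the powers of
    theta of exponent less than 'C(2q, q) are linearly independent over the
    polynomials in the E_k (coefform_independent).  Independence passes to the
    forms L_k = s B_k + E_k with s an indeterminate, because a relation can be
    divided by a power of s and then specialised at s = 0
    (form_independent).  In the other direction, comparing the number of
    polynomials in the L_k of degree at most N with the number of monomials of
    degree at most N + c in u and in v shows that over the fraction field of
    the polynomials in the L_k every polynomial in u and v is a combination of
    those powers of theta (form_dependent).

    Hence theta has degree 'C(2q, q) = 2D over that field, with D odd.  The
    exchange of u and v fixes the L_k and changes the sign of theta, so
    w = theta^2 is a root of a polynomial G of degree D, and u = a + theta c,
    v = a - theta c with a and c rational in w (elimination).  After any
    generic specialisation of s and of the values t_k of the L_k to real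
    numbers, G keeps its odd degree and has a real root w
    (deformed_real_points); w >= 0 gives a real pair and w < 0 a conjugate
    pair.  The t_k stay fixed while s tends to infinity, so dividing by s and
    using compactness of the unit sphere yields a zero of the B_k themselves
    (no_points_far). *)

(** * Parity and growth of binomial coefficients *)
Section Counting.
Local Open Scope nat_scope.

(** By Pascal's rule, as the inner entries 'C(2^k, i) of the next row are even:
    2^k divides i * 'C(2^k, i), so if this entry were odd, 2^k would divide
    i. *)
Lemma odd_bin_pred2X k i : i < 2 ^ k -> odd 'C((2 ^ k).-1, i).
Proof.
have q0 : 0 < 2 ^ k by rewrite expn_gt0.
elim: i => [|i IHi] ltik; first by rewrite bin0.
have {IHi} oddi := IHi (ltnW ltik).
have : odd 'C(2 ^ k, i.+1) = false.
  apply/negbTE/negP => oddb.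
  have E := mul_bin_diag (2 ^ k) i.
  have : 2 ^ k %| i.+1 * 'C(2 ^ k, i.+1) by rewrite -E dvdn_mulr.
  rewrite Gauss_dvdl ?coprimeXl ?coprime2n //.
  by move/dvdn_leq => /(_ isT); rewrite leqNgt ltik.
rewrite -[X in odd (binomial X _)](prednK q0) binS oddD oddi.
by case: odd.
Qed.

Lemma bin_central_half q : 0 < q -> 'C(q + q, q) = 'C((q + q).-1, q.-1).*2.
Proof.
case: q => // q _; rewrite addSn /= binS -addnn; congr (_ + _).
by rewrite -[RHS]bin_sub ?leq_addr // addKn.
Qed.

Lemma odd_bin_central k :
  exists2 D, odd D & 'C(2 ^ k + 2 ^ k, 2 ^ k) = D.*2.
Proof.
exists 'C((2 ^ k.+1).-1, (2 ^ k).-1).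
  by apply: odd_bin_pred2X; apply: leq_ltn_trans (leq_pred _) _; rewrite ltn_exp2l.
by rewrite bin_central_half ?expn_gt0 // expnS mul2n addnn.
Qed.

Lemma expn_leS r K : K.+1 ^ r <= K ^ r + r * K.+1 ^ r.-1.
Proof.
elim: r => [|r IHr]; first by rewrite !expn0.
rewrite /= expnS mulSn mulSn addnCA leq_add2l.
apply: leq_trans (leq_mul (leqnn K) IHr) _.
rewrite mulnDr expnS leq_add2l mulnCA leq_mul2l; apply/orP.
case: r {IHr} => [|r]; [by left | right].
by rewrite /= expnS leq_mul2r leqnSn orbT.
Qed.

(** Bernoulli's inequality (1 - 1/(K+1))^r >= 1 - r/(K+1), in the form of
    expn_leS, with N = d * K and K large enough. *)
Lemma expn_growth C d r : exists N, C * (N + d) ^ r < C.+1 * N ^ r.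
Proof.
case: r => [|r]; first by exists 0; rewrite !expn0 !muln1.
case: d => [|d].
  by exists 1; rewrite addn0 !exp1n !muln1.
have [K defK] : {K | K = C.+1 * r.+1} by exists (C.+1 * r.+1).
exists (d.+1 * K).
rewrite -mulnSr !expnMn !(mulnCA _ (d.+1 ^ _)) ltn_mul2l expn_gt0 /=.
have := leq_mul (leqnn C.+1) (expn_leS r.+1 K); rewrite mulnDr /=.
rewrite mulnA -defK; set x := C.+1 * K ^ _ => le_x.
rewrite -(ltn_add2r (K * K.+1 ^ r)); apply: leq_trans le_x.
rewrite mulSn [ltnRHS]addnC ltn_add2l expnS ltn_mul2r expn_gt0 /=.
by rewrite ltnSn.
Qed.

(** Both sides are polynomials in N of degree 2q; the leading coefficient
    1/(q!)^2 of the left one is 'C(2q, q) times the coefficient 1/(2q)! of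
    'C(N + 2q, 2q), so one extra copy of the latter wins. *)
Lemma bin_growth q c :
  exists N, 'C(N + c + q, q) ^ 2 < 'C(q + q, q).+1 * 'C(N + (q + q), q + q).
Proof.
have [N ltN] := expn_growth 'C(q + q, q) (c + q) (q + q); exists N.
rewrite -(@ltn_pmul2r ((q + q)`!)) ?fact_gt0 // -mulnA bin_ffact.
rewrite -(@bin_fact (q + q) q) ?leq_addr // addnK.
set C := 'C(q + q, q) in ltN *.
have -> : 'C(N + c + q, q) ^ 2 * (C * (q`! * q`!))
  = C * ((N + c + q) ^_ q) ^ 2.
  by rewrite -bin_ffact expnMn mulnCA mulnn.
have le_ff n m : n ^_ m <= n ^ m.
  elim: m n => [|m IHm] [|n] //; rewrite ffactnS expnS leq_mul //.
  by apply: leq_trans (IHm _) _; case: m {IHm} => // m; rewrite leq_exp2r.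
have ge_ff n m : n ^ m <= (n + m) ^_ m.
  elim: m => // m IHm; rewrite addnS ffactSS expnS leq_mul //.
  by rewrite -addnS leq_addr.
apply: leq_ltn_trans (leq_trans ltN (leq_mul (leqnn _) (ge_ff _ _))).
rewrite leq_mul2l addnA; apply/orP; right.
by rewrite expnD -mulnn leq_mul.
Qed.

End Counting.

(** * Linear systems over a domain *)
Section Pigeonhole.

(** Padding with zero columns makes the system square with determinant 0, so no
    fraction field is needed to find a solution in the domain itself. *)
Lemma underdetermined_system (A : idomainType) (I J : finType) (M : I -> J -> A) :
  (#|J| < #|I|)%N ->
  exists2 v : I -> A, exists i, v i != 0 & forall j, \sum_i v i * M i j = 0.
Proof.
move=> ltJI.
pose N : 'M[A]_#|I| := \matrix_(i, c)
  if (insub (val c) : option 'I_#|J|) is Some d then M (enum_val i) (enum_val d) else 0.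
have /eqP/det0P[v v0 vN] : \det N = 0.
  rewrite (expand_det_col _ (Ordinal ltJI)) big1 // => i _.
  by rewrite mxE insubF ?mul0r //= ltnn.
exists (fun i => v 0 (enum_rank i)).
  have /rV0Pn[i vi] := v0; exists (enum_val i).
  by rewrite enum_valK.
move=> j.
have /rowP/(_ (widen_ord (ltnW ltJI) (enum_rank j))) := vN.
rewrite !mxE => E; rewrite -[RHS]E.
rewrite [LHS](reindex _ (onW_bij _ (@enum_val_bij I))) /=.
apply: eq_bigr => i _; rewrite mxE /= enum_valK insubT // => lt.
by congr (_ * M _ _); rewrite -[LHS]enum_rankK; congr enum_val; apply: val_inj.
Qed.

End Pigeonhole.

(** * Multivariate polynomials *)
Section Polynomials.
Import mpoly.

(** A monomial is its tuple of exponents, so this counts tuples of naturals of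
    bounded sum. *)
Lemma card_bmultinom n d : #|{: 'X_{1..n < d.+1}}| = 'C(n + d, n).
Proof.
rewrite -card_partial_ord_partitions.
pose f (m : 'X_{1..n < d.+1}) : n.-tuple 'I_d.+1 := [tuple inord (m i) | i < n].
have fE m i : tnth (f m) i = m i :> nat.
  rewrite tnth_mktuple inordK //; apply: leq_ltn_trans (bmdeg m).
  by rewrite mdegE (bigD1 i) //= leq_addr.
rewrite -(card_imset _ (_ : injective f)); last first.
  by move=> m1 m2 eq_f; apply/val_inj/mnmP => i; rewrite -!fE eq_f.
apply: eq_card => t; rewrite inE; apply/imsetP/idP => [[m _ ->]|le_t].
  rewrite big_tuple (eq_bigr _ (fun i _ => fE m i)) -mdegE -ltnS.
  exact: bmdeg.
have lt_t : (mdeg [multinom val (tnth t i) | i < n] < d.+1)%N.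
  rewrite mdegE ltnS (leq_trans _ le_t) // big_tuple.
  by rewrite (eq_bigr _ (fun i _ => mnmE _ i)).
exists (BMultinom lt_t) => //; apply: eq_from_tnth => i; apply: ord_inj.
by rewrite fE /= mnmE.
Qed.

Lemma mpoly_rmorph_ext (A : nzRingType) (B : comNzRingType) n
    (f g : {rmorphism {mpoly A[n]} -> B}) :
  (forall c, f c%:MP = g c%:MP) -> (forall i, f 'X_i = g 'X_i) -> f =1 g.
Proof.
move=> fgC fgX p; rewrite (mpolyE p) !rmorph_sum; apply: eq_bigr => m _.
rewrite -mul_mpolyC !rmorphM fgC mpolyXE_id !rmorph_prod; congr (_ * _).
by apply: eq_bigr => i _; rewrite !rmorphXn fgX.
Qed.

Lemma digits_inj b n (m m' : 'I_n -> nat) :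
  (forall i, m i < b)%N -> (forall i, m' i < b)%N ->
  (\sum_(i < n) m i * b ^ i = \sum_(i < n) m' i * b ^ i)%N -> m =1 m'.
Proof.
elim: n m m' => [|n IHn] m m' ltm ltm' E; first by case.
have Es (f : 'I_n.+1 -> nat) : (\sum_(i < n.+1) f i * b ^ i
    = (\sum_(i < n) f (lift ord0 i) * b ^ i) * b + f ord0)%N.
  rewrite big_ord_recl expn0 muln1 addnC big_distrl /=; congr (_ + _)%N.
  by apply: eq_bigr => i _; rewrite /bump /= expnS -mulnA (mulnC b).
rewrite !Es in E; have b0 : (0 < b)%N by apply: leq_ltn_trans (ltm ord0).
have E0 : m ord0 = m' ord0.
  by have := congr1 (modn^~ b) E; rewrite !modnMDl !modn_small.
move: E; rewrite E0 => /addIn/eqP; rewrite eqn_pmul2r // => /eqP E i.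
case: (unliftP ord0 i) => [j ->|-> //].
exact: (IHn (fun j => m (lift ord0 j)) (fun j => m' (lift ord0 j))).
Qed.

Lemma poly_nonroot (A : idomainType) (p : {poly A}) (c : nat -> A) :
  injective c -> p != 0 -> exists x, ~~ root p (c x).
Proof.
move=> cI p0; pose s := [seq c x | x <- iota 0 (size p)].
have : ~~ all (root p) s.
  apply/negP => rs; have := max_poly_roots p0 rs.
  by rewrite map_inj_uniq // iota_uniq size_map size_iota ltnn => /(_ isT).
by case/allPn => _ /mapP[x _ ->] ?; exists x.
Qed.

(** Kronecker substitution: for b larger than all the exponents, distinct
    monomials of p become distinct powers of x under X_i := x^(b^i), by
    uniqueness of the digits in base b, so p becomes a nonzero polynomial in
    one variable. *)
Lemma mpoly_nonroot (A : idomainType) n (p : {mpoly A[n]}) (c : nat -> A) :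
  injective c -> p != 0 ->
  exists x : nat, exists b : nat, p.@[fun i => c x ^+ (b ^ i)] != 0.
Proof.
move=> cI p0; pose b := msize p.
pose P : {poly A} := \sum_(m <- msupp p) p@_m *: 'X^(\sum_(i < n) m i * b ^ i).
have evalP x : p.@[fun i => x ^+ (b ^ i)] = P.[x].
  rewrite mevalE horner_sum; apply: eq_bigr => m _.
  rewrite hornerZ hornerXn expr_sum; congr (_ * _).
  by apply: eq_bigr => i _; rewrite -exprM mulnC.
have ltb m i : m \in msupp p -> (m i < b)%N.
  move=> /msize_mdeg_lt; apply: leq_ltn_trans.
  by rewrite mdegE (bigD1 i) //= leq_addr.
have P0 : P != 0.
  have m0p := mlead_supp p0; set m0 := mlead p in m0p.
  suff: P`_(\sum_(i < n) m0 i * b ^ i) != 0.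
    by apply: contraNneq => ->; rewrite coef0.
  rewrite coef_sum (bigD1_seq m0) ?msupp_uniq //= coefZ coefXn eqxx mulr1.
  rewrite big_seq_cond big1 => [|m]; first by rewrite addr0 -mcoeff_msupp.
  case/andP=> mp ne_m; rewrite coefZ coefXn; case: eqP => [E|]; last by rewrite mulr0.
  case/eqP: ne_m; apply/mnmP/(@digits_inj b); last exact/esym.
    by move=> i; apply: ltb.
  by move=> i; apply: ltb.
suff [x Px] : exists x, ~~ root P (c x) by exists x, b; rewrite evalP.
exact: poly_nonroot.
Qed.

End Polynomials.

(** * Bilinear forms and products of polynomials *)
Section BilinearForms.

Definition bform (A : comNzRingType) n (M : 'M[A]_n) (x y : 'rV[A]_n) : A :=
  (x *m M *m y^T) 0 0.

Lemma bformE (A : comNzRingType) n (M : 'M[A]_n) x y :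
  bform M x y = \sum_i \sum_j x 0 i * M i j * y 0 j.
Proof.
rewrite /bform mxE exchange_big; apply: eq_bigr => j _ /=.
by rewrite !mxE mulr_suml.
Qed.

Lemma bform_map (A B : comNzRingType) (f : {rmorphism A -> B}) n
    (M : 'M[A]_n) x y :
  f (bform M x y) = bform (map_mx f M) (map_mx f x) (map_mx f y).
Proof. by rewrite /bform matrix.map_trmx -!map_mxM [RHS]mxE. Qed.

Lemma bformDl (A : comNzRingType) n (M : 'M[A]_n) x y z :
  bform M (x + y) z = bform M x z + bform M y z.
Proof. by rewrite /bform !mulmxDl mxE. Qed.

Lemma bformDr (A : comNzRingType) n (M : 'M[A]_n) x y z :
  bform M x (y + z) = bform M x y + bform M x z.
Proof. by rewrite /bform linearD mulmxDr mxE. Qed.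

Lemma bformZl (A : comNzRingType) n (M : 'M[A]_n) a x y :
  bform M (a *: x) y = a * bform M x y.
Proof. by rewrite /bform -!scalemxAl mxE. Qed.

Lemma bformZr (A : comNzRingType) n (M : 'M[A]_n) a x y :
  bform M x (a *: y) = a * bform M x y.
Proof. by rewrite /bform linearZ -scalemxAr mxE. Qed.

Lemma bformC (A : comNzRingType) n (M : 'M[A]_n) x y :
  M^T = M -> bform M x y = bform M y x.
Proof.
move=> symM; rewrite /bform; have -> : x *m M *m y^T = (y *m M *m x^T)^T.
  by rewrite !trmx_mul trmxK symM mulmxA.
by rewrite [LHS]mxE.
Qed.

Lemma bform_conjugate (A : comNzRingType) n (M : 'M[A]_n) t x y :
  M^T = M ->
  bform M (x + t *: y) (x - t *: y) = bform M x x - t ^+ 2 * bform M y y.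
Proof.
move=> symM; rewrite -scaleNr bformDl !bformDr !bformZl !bformZr.
by rewrite (bformC y x symM); ring.
Qed.

(** The form E_k: the coefficient of z^k in the product of the polynomials
    with coefficient vectors x and y, as bform_coefform shows. *)
Definition coefform (A : comNzRingType) (q k : nat) : 'M[A]_q.+1 :=
  \matrix_(i, j) ((i + j)%N == k)%:R.

Lemma map_coefform (A B : comNzRingType) (f : {rmorphism A -> B}) q k :
  map_mx f (coefform A q k) = coefform B q k.
Proof. by apply/matrixP => i j; rewrite !mxE rmorph_nat. Qed.

Lemma bform_coefform (A : comNzRingType) q k (p r : {poly A}) :
  (size p <= q.+1)%N -> (size r <= q.+1)%N ->
  bform (coefform A q k) (\row_i p`_i) (\row_i r`_i) = (p * r)`_k.
Proof.
move=> sp sr; rewrite bformE.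
have polyX (s : {poly A}) : (size s <= q.+1)%N -> s = \sum_(i < q.+1) s`_i *: 'X^i.
  move=> ss; rewrite -poly_def; apply/polyP => i; rewrite coef_poly.
  by case: ltnP => // /(leq_trans ss)/leq_sizeP ->.
rewrite {2}(polyX _ sp) {2}(polyX _ sr) mulr_suml coef_sum.
apply: eq_bigr => i _; rewrite mulr_sumr coef_sum; apply: eq_bigr => j _.
rewrite !mxE -scalerAl -scalerAr -exprD !coefZ coefXn eq_sym.
by rewrite -mulrA [_ * r`_j]mulrC.
Qed.

End BilinearForms.

(** * Independence of the powers of theta over the product coefficients *)
Section Independence.
Import mpoly.

Lemma mesym_evalX (A : comNzRingType) n k :
  (mesym n {mpoly A[n]} k).@[fun i => 'X_i] = mesym n A k.
Proof.
rewrite /mesym raddf_sum /=; apply: eq_bigr => h _; rewrite rmorph_prod.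
by apply: eq_bigr => i _; rewrite /= mevalXU.
Qed.

Definition rootsX (A : nzRingType) n (S : {set 'I_n}) : seq {mpoly A[n]} :=
  [seq 'X_i | i in S].

Definition rootpoly (A : comNzRingType) n (S : {set 'I_n}) : {poly {mpoly A[n]}} :=
  \prod_(x <- rootsX A S) ('X - x%:P).

Lemma rootpolyE A n (S : {set 'I_n}) :
  rootpoly A S = \prod_(i in S) ('X - ('X_i)%:P).
Proof. by rewrite /rootpoly big_image. Qed.

(** Sends X_k to the coefficient of z^k in the product of all z - X_i, that is,
    to an elementary symmetric polynomial up to sign. *)
Definition coef_subst (A : comNzRingType) n :
    {rmorphism {mpoly A[n]} -> {mpoly A[n]}} :=
  comp_mpoly [tuple (rootpoly A [set: 'I_n])`_k | k < n].

(** The coefficients of the generic monic polynomial are, up to sign and order,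
    the elementary symmetric polynomials of its roots, which are algebraically
    independent. *)
Lemma coef_subst_inj (A : idomainType) n (p : {mpoly A[n]}) :
  coef_subst A n p = 0 -> p = 0.
Proof.
pose S := [tuple mesym n A i.+1 | i < n].
(* r reverses the order of the variables with signs, and r' undoes it *)
pose c (k : 'I_n) : {mpoly A[n]} := (-1) ^+ (n - k) * 'X_(rev_ord k).
pose c' (k : 'I_n) : {mpoly A[n]} := (-1) ^+ k.+1 * 'X_(rev_ord k).
pose r := comp_mpoly [tuple c k | k < n].
pose r' := comp_mpoly [tuple c' k | k < n].
have rE : coef_subst A n p = comp_mpoly S (r p).
  apply: (mpoly_rmorph_ext (f := coef_subst A n)
    (g := comp_mpoly S \o r)) => [x|k] /=.
    by rewrite /coef_subst /r !comp_mpolyC.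
  rewrite /coef_subst /r !comp_mpolyXU !nth_mktuple /c rmorphM rmorphXn rmorphN1 /=.
  pose j : 'I_n.+1 := lift ord0 (rev_ord k).
  have Ej : (n - j = k)%N by rewrite /= /bump add1n subnSK // subKn // ltnW.
  have := mroots_coeff [tuple 'X_i : {mpoly A[n]} | i < n] j.
  rewrite Ej (@meval_eq _ _ _ (fun i => 'X_i)) => [|i]; last by rewrite tnth_mktuple.
  rewrite mesym_evalX comp_mpolyXU nth_mktuple /= /bump add1n subnSK // => <-.
  rewrite rootpolyE big_map big_enum; congr (polyseq _)`_ _.
  by apply: eq_bigl => i; rewrite inE.
move=> p0; have {}p0 : r p = 0.
  by apply: (@msym_fundamental_un0 n A); rewrite -[LHS]rE.
have rK : r' (r p) = p.
  rewrite -[RHS](comp_mpoly_id p).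
  apply: (mpoly_rmorph_ext (f := r' \o r)
    (g := comp_mpoly [tuple 'X_i | i < n])) => [x|k] /=.
    by rewrite /r' /r !comp_mpolyC.
  rewrite /r' /r !comp_mpolyXU !nth_mktuple /c rmorphM rmorphXn rmorphN1 /=.
  rewrite comp_mpolyXU nth_mktuple /c' rev_ordK /= subnSK // mulrA -exprD.
  by rewrite -signr_odd addnn odd_double expr0 mul1r.
by rewrite -rK p0 /r' raddf0.
Qed.

End Independence.

Section Generic.
Import mpoly.
Variables (A : comNzRingType) (q : nat).

(** The coefficient vector of a monic polynomial of degree q, whose lower
    coefficients are the X i. *)
Definition monic_row (X : 'I_q -> {mpoly A[q + q]}) : 'rV[{mpoly A[q + q]}]_q.+1 :=
  \row_j if unlift ord_max j is Some i then X i else 1.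

Definition genu := monic_row (fun i => 'X_(lshift q i)).
Definition genv := monic_row (fun i => 'X_(rshift q i)).

Definition theta (i : 'I_q) : {mpoly A[q + q]} :=
  'X_(lshift q i) - 'X_(rshift q i).

(** The subring of polynomials in u and v generated by the forms L k is the
    image of this substitution; the variables of its source, one for each form,
    stand for the values of the forms. *)
Definition form_subst (L : 'I_(q + q) -> 'M[A]_q.+1) :
    {rmorphism {mpoly A[q + q]} -> {mpoly A[q + q]}} :=
  comp_mpoly
    [tuple bform (map_mx (@mpolyC _ _) (L k)) genu genv | k < q + q].

Lemma form_substC L c : form_subst L c%:MP = c%:MP.
Proof. exact: comp_mpolyC. Qed.

Lemma form_substX L k :
  form_subst L 'X_k = bform (map_mx (@mpolyC _ _) (L k)) genu genv.
Proof. by rewrite /form_subst /= comp_mpolyXU nth_mktuple. Qed.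

Lemma form_substZ L c p : form_subst L (c *: p) = c *: form_subst L p.
Proof. exact: comp_mpolyZ. Qed.

End Generic.

Section Independence0.
Import mpoly.
Variables (A : idomainType) (q : nat).

(** Replaces (u, v) by the factorisation of the product of all z - X_i in which
    S is the set of roots of the first factor. *)
Definition factor_subst (S : {set 'I_(q + q)}) :
    {rmorphism {mpoly A[q + q]} -> {mpoly A[q + q]}} :=
  comp_mpoly [tuple match split k with
    | inl i => (rootpoly A S)`_i
    | inr i => (rootpoly A (~: S))`_i
    end | k < q + q].

Lemma factor_substC S c : factor_subst S c%:MP = c%:MP.
Proof. exact: comp_mpolyC. Qed.

Lemma factor_substXl S i :
  factor_subst S 'X_(lshift q i) = (rootpoly A S)`_i.
Proof.
rewrite /factor_subst /= comp_mpolyXU nth_mktuple.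
by rewrite (unsplitK (inl i : 'I_q + 'I_q)).
Qed.

Lemma factor_substXr S i :
  factor_subst S 'X_(rshift q i) = (rootpoly A (~: S))`_i.
Proof.
rewrite /factor_subst /= comp_mpolyXU nth_mktuple.
by rewrite (unsplitK (inr i : 'I_q + 'I_q)).
Qed.

Lemma size_rootpoly (S : {set 'I_(q + q)}) : size (rootpoly A S) = #|S|.+1.
Proof. by rewrite size_prod_XsubC size_image. Qed.

Lemma rootpoly_top (S : {set 'I_(q + q)}) : #|S| = q -> (rootpoly A S)`_q = 1.
Proof.
move=> Sq; have := monic_prod_XsubC (rootsX A S) xpredT id.
by rewrite monicE lead_coefE -/(rootpoly A S) size_rootpoly Sq => /eqP.
Qed.

Lemma card_setC_half (S : {set 'I_(q + q)}) : #|S| = q -> #|~: S| = q.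
Proof. by move=> Sq; rewrite cardsCs setCK card_ord Sq addnK. Qed.

Lemma factor_subst_genu (S : {set 'I_(q + q)}) : #|S| = q ->
  map_mx (factor_subst S) (genu A q) = \row_j (rootpoly A S)`_j.
Proof.
move=> Sq; apply/rowP => j; rewrite !mxE; case: unliftP => [i ->|->].
  by rewrite factor_substXl lift_max.
by rewrite rmorph1 rootpoly_top.
Qed.

Lemma factor_subst_genv (S : {set 'I_(q + q)}) : #|S| = q ->
  map_mx (factor_subst S) (genv A q) = \row_j (rootpoly A (~: S))`_j.
Proof.
move=> Sq; apply/rowP => j; rewrite !mxE; case: unliftP => [i ->|->].
  by rewrite factor_substXr lift_max.
by rewrite rmorph1 rootpoly_top // card_setC_half.
Qed.

(** All the factorisations have the same product, so this does not depend on
    S. *)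
Lemma factor_subst_coefform (S : {set 'I_(q + q)}) p : #|S| = q ->
  factor_subst S (form_subst (fun k => coefform A q k) p) = coef_subst A _ p.
Proof.
move=> Sq.
apply: (mpoly_rmorph_ext (f := factor_subst S \o form_subst (fun k => coefform A q k))
  (g := coef_subst A (q + q))) => [c|k] /=.
  by rewrite form_substC factor_substC /coef_subst comp_mpolyC.
rewrite form_substX bform_map -map_mx_comp factor_subst_genu // factor_subst_genv //.
have -> : map_mx (factor_subst S \o @mpolyC _ _) (coefform A q k) = coefform _ q k.
  by apply/matrixP => i j; rewrite !mxE /= factor_substC mpolyC_nat.
rewrite bform_coefform ?size_rootpoly ?card_setC_half ?Sq //.
rewrite /coef_subst /= comp_mpolyXU nth_mktuple !rootpolyE.
congr (polyseq _)`_ _; rewrite [RHS](bigID (mem S)) /=; congr (_ * _).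
  by apply: eq_bigl => i; rewrite !inE.
by apply: eq_bigl => i; rewrite !inE.
Qed.

Lemma factor_subst_theta (S : {set 'I_(q + q)}) (i : 'I_q) : #|S| = q -> i.+1 = q ->
  factor_subst S (theta A i) = \sum_(j in ~: S) 'X_j - \sum_(j in S) 'X_j.
Proof.
move=> Sq iq; rewrite rmorphB factor_substXl factor_substXr.
have cE (T : {set 'I_(q + q)}) : #|T| = q ->
    (rootpoly A T)`_i = - \sum_(j in T) 'X_j.
  move=> Tq; have -> : nat_of_ord i = (size (rootsX A T)).-1.
    by rewrite size_image Tq -(congr1 predn iq).
  by rewrite coefPn_prod_XsubC ?big_image // size_image Tq -iq.
by rewrite !cE ?card_setC_half // opprK addrC.
Qed.

(** The coefficient of X_j in the image of theta is -1 or 1 according as j is in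
    S or not. *)
Lemma factor_subst_theta_inj (i : 'I_q) : 2%:R != 0 :> A -> i.+1 = q ->
  {in [set S : {set 'I_(q + q)} | #|S| == q] &,
    injective (fun S => factor_subst S (theta A i))}.
Proof.
move=> two iq S T; rewrite !inE => /eqP Sq /eqP Tq.
rewrite !factor_subst_theta // => E; apply/setP => j.
have cE (U : {set 'I_(q + q)}) :
    (\sum_(k in ~: U) 'X_k - \sum_(k in U) 'X_k : {mpoly A[q + q]})@_U_(j)
    = (-1) ^+ (j \in U).
  have cE1 (V : {set 'I_(q + q)}) :
      (\sum_(k in V) 'X_k : {mpoly A[q + q]})@_U_(j) = (j \in V)%:R.
    rewrite raddf_sum /=; case: (boolP (j \in V)) => jV; last first.
      rewrite big1 // => k kV; rewrite mcoeffXU; case: eqP => // kj.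
      by rewrite -kj kV in jV.
    rewrite (bigD1 j) //= mcoeffXU eqxx big1 ?addr0 // => k /andP[_ kj].
    by rewrite mcoeffXU (negPf kj).
  rewrite mcoeffB !cE1 inE; case: (j \in U); first by rewrite sub0r.
  by rewrite subr0.
move: (cE S); rewrite E cE; case: (j \in S); case: (j \in T) => // /eqP.
  by rewrite -addr_eq0 -[1 + _]/(2%:R) (negPf two).
by rewrite eq_sym -addr_eq0 -[1 + _]/(2%:R) (negPf two).
Qed.

(** A relation among the powers of theta is a polynomial that, after
    substitution, has the same coefficients for every factorisation of the
    generic polynomial of degree 2q, and the value of theta at each of them as
    a root.  These are 'C(2q, q) distinct roots, more than its degree allows. *)
Lemma coefform_independent (i : 'I_q) (P : {poly {mpoly A[q + q]}}) :
  2%:R != 0 :> A -> i.+1 = q ->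
  (size P <= 'C(q + q, q))%N ->
  (map_poly (form_subst (fun k => coefform A q k)) P).[theta A i] = 0 -> P = 0.
Proof.
move=> two iq sP root_th.
suff P0 : map_poly (coef_subst A (q + q)) P = 0.
  apply/polyP => j; rewrite coef0; apply: coef_subst_inj.
  by rewrite -[LHS]coef_map P0 coef0.
apply/eqP/negPn/negP => P0.
pose rs := [seq factor_subst X (theta A i) |
  X <- enum [set X : {set 'I_(q + q)} | #|X| == q]].
have : all (root (map_poly (coef_subst A (q + q)) P)) rs.
  apply/allP => _ /mapP[S + ->]; rewrite mem_enum inE => /eqP Sq.
  apply/rootP; have := congr1 (factor_subst S) root_th.
  rewrite rmorph0 -horner_map -map_poly_comp => E; rewrite -[RHS]E.
  congr (horner _ _); apply: eq_map_poly => x /=.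
  by rewrite factor_subst_coefform.
move/(max_poly_roots P0); rewrite map_inj_in_uniq; last first.
  by move=> S T; rewrite !mem_enum; apply: factor_subst_theta_inj.
rewrite enum_uniq size_map -cardE card_draws card_ord => /(_ isT).
by rewrite ltnNge (leq_trans (size_poly _ _)).
Qed.

End Independence0.

(** * Passing to a deformation of the product coefficients *)
Section IndependenceDeformation.
Import mpoly.
Variables (F : idomainType) (q : nat) (L : 'I_(q + q) -> 'M[{poly F}]_q.+1).
Hypothesis L0 : forall k, map_mx (horner_eval 0) (L k) = coefform F q k.
Hypothesis two : 2%:R != 0 :> F.

Let spec : {rmorphism {mpoly {poly F}[q + q]} -> {mpoly F[q + q]}} :=
  map_mpoly (horner_eval 0).

Let specX k : spec 'X_k = 'X_k.
Proof. exact: map_mpolyX. Qed.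

Let specC c : spec c%:MP = c.[0]%:MP.
Proof. exact: map_mpolyC. Qed.

Let spec_row (f : 'I_q -> 'I_(q + q)) :
  map_mx spec (monic_row (fun i => 'X_(f i))) = monic_row (fun i => 'X_(f i)).
Proof.
by apply/rowP => j; rewrite !mxE; case: unlift => [i|]; rewrite ?specX ?rmorph1.
Qed.

Let spec_form_subst p :
  spec (form_subst L p) = form_subst (fun k => coefform F q k) (spec p).
Proof.
apply: (mpoly_rmorph_ext (f := spec \o form_subst L)
  (g := form_subst (fun k => coefform F q k) \o spec)) => [c|k] /=.
  by rewrite form_substC specC form_substC.
rewrite specX !form_substX bform_map -map_mx_comp.
have -> : map_mx spec (genu _ q) = genu _ q by apply: spec_row.
have -> : map_mx spec (genv _ q) = genv _ q by apply: spec_row.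
suff -> : map_mx (spec \o @mpolyC _ _) (L k) = map_mx (@mpolyC _ _) (coefform F q k).
  by [].
by rewrite -L0 -map_mx_comp; apply/matrixP => i j; rewrite !mxE /= specC.
Qed.

(** At s = 0 the relation becomes one over the product coefficients, hence
    trivial; so every coefficient of the given relation is divisible by s, the
    quotient is again a relation, and the coefficients are divisible by all
    powers of s. *)
Lemma form_independent (i : 'I_q) (P : {poly {mpoly {poly F}[q + q]}}) :
  i.+1 = q -> (size P <= 'C(q + q, q))%N ->
  (map_poly (form_subst L) P).[theta _ i] = 0 -> P = 0.
Proof.
move=> iq sP rootP.
suff dvdXn n : forall j m, exists c : {poly F}, ((P`_j)@_m : {poly F}) = 'X^n * c.
  apply/polyP => j; apply/mpolyP => m; rewrite coef0 mcoeff0.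
  have [c] := dvdXn (size (P`_j)@_m) j m.
  have [-> ->|c0 E] := eqVneq c 0; first by rewrite mulr0.
  have := congr1 (fun p : {poly F} => size p) E.
  rewrite /= size_monicM ?monicXn // size_polyXn addSn /= => /esym/eqP.
  by rewrite -[X in _ == X]addn0 eqn_add2l size_poly_eq0 (negPf c0).
elim: n P sP rootP => [|n IHn] P sP rootP j m.
  by exists (P`_j)@_m; rewrite mul1r.
pose div : {mpoly {poly F}[q + q]} -> {mpoly {poly F}[q + q]} :=
  map_mpoly (drop_poly 1).
pose Q := map_poly div P.
have div0 : div 0 = 0 by apply: raddf0.
have PE : P = 'X%:MP *: Q.
  have sP0 : map_poly spec P = 0.
    apply: (@coefform_independent _ _ i) => //.
      by apply: leq_trans (size_poly _ _) sP.
    have := congr1 spec rootP; rewrite rmorph0 -horner_map -map_poly_comp => E.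
    rewrite -[RHS]E -map_poly_comp /theta rmorphB /= !specX; congr horner.
    by apply: eq_map_poly => x /=; rewrite spec_form_subst.
  apply/polyP => k; rewrite coefZ coef_map_id0 // mul_mpolyC.
  apply/mpolyP => l; rewrite mcoeffZ mcoeff_map_mpoly /= mulrC.
  rewrite -['X]expr1 -{1}[P`_k@_l](poly_take_drop 1) -[RHS]add0r.
  congr (_ + _); have := congr1 (fun R : {poly _} => R`_k@_l) sP0.
  rewrite /= coef_map coef0 mcoeff0 mcoeff_map_mpoly /= /horner_eval horner_coef0 => E.
  by apply/polyP => -[|a]; rewrite coef_take_poly coef0.
have X0 : 'X%:MP != 0 :> {mpoly {poly F}[q + q]} by rewrite mpolyC_eq0 polyX_eq0.
have [|| c Ec] := IHn Q _ _ j m.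
- by rewrite -(size_scale _ X0) -PE.
- move: rootP; rewrite PE map_polyZ hornerZ /= form_substC => /eqP.
  by rewrite mulf_eq0 (negPf X0) => /eqP.
by exists c; rewrite PE coefZ mul_mpolyC mcoeffZ Ec exprS mulrA.
Qed.

End IndependenceDeformation.

(** * Dependence of the powers of theta: counting monomials *)
Section Bidegree.
Import mpoly.
Variables (A : idomainType) (q : nat).
Implicit Types (p r : {mpoly A[q + q]}) (m : 'X_{1..q + q}).

(** The degrees in the variables of u and in those of v are bounded separately:
    a bound on the total degree would allow too many monomials for the count in
    form_dependent. *)
Definition ldeg m := (\sum_(i < q) m (lshift q i))%N.
Definition rdeg m := (\sum_(i < q) m (rshift q i))%N.

Definition bideg_le a b p : bool :=
  all (fun m => (ldeg m <= a)%N && (rdeg m <= b)%N) (msupp p).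

Lemma bideg_leP a b p :
  reflect {in msupp p, forall m, (ldeg m <= a)%N /\ (rdeg m <= b)%N}
          (bideg_le a b p).
Proof. by apply: (iffP allP) => bp m /bp/andP. Qed.

Lemma bideg_leW a b a' b' p :
  bideg_le a b p -> (a <= a')%N -> (b <= b')%N -> bideg_le a' b' p.
Proof.
move=> /bideg_leP bp la lb; apply/bideg_leP => m /bp[lm rm].
by split; [apply: leq_trans la|apply: leq_trans lb].
Qed.

Lemma bideg_le0 a b : bideg_le a b 0.
Proof. by rewrite /bideg_le msupp0. Qed.

Lemma bideg_leD a b p r : bideg_le a b p -> bideg_le a b r -> bideg_le a b (p + r).
Proof.
move=> /bideg_leP bp /bideg_leP br; apply/bideg_leP => m /msuppD_le.
by rewrite mem_cat => /orP[/bp|/br].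
Qed.

Lemma bideg_leN a b p : bideg_le a b (- p) = bideg_le a b p.
Proof. by apply: eq_all_r => m; rewrite (perm_mem (msuppN _)). Qed.

Lemma bideg_le_sum (I : Type) (s : seq I) a b (G : I -> {mpoly A[q + q]}) :
  (forall i, bideg_le a b (G i)) -> bideg_le a b (\sum_(i <- s) G i).
Proof.
move=> bG; elim/big_rec: _ => [|i p _]; first exact: bideg_le0.
exact: bideg_leD.
Qed.

Lemma bideg_leM a b a' b' p r : bideg_le a b p -> bideg_le a' b' r ->
  bideg_le (a + a') (b + b') (p * r).
Proof.
move=> /bideg_leP bp /bideg_leP br; apply/bideg_leP => m.
move=> /msuppM_le/allpairsP[[m1 m2] /= [/bp[l1 r1] /br[l2 r2] ->]].
rewrite /ldeg /rdeg; split.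
  rewrite (eq_bigr _ (fun i _ => mnmDE _ _ _)) big_split; exact: leq_add.
rewrite (eq_bigr _ (fun i _ => mnmDE _ _ _)) big_split; exact: leq_add.
Qed.

Lemma bideg_leZ a b c p : bideg_le a b p -> bideg_le a b (c *: p).
Proof. by move=> /bideg_leP bp; apply/bideg_leP => m /msuppZ_le/bp. Qed.

Lemma bideg_leC c : bideg_le 0 0 c%:MP.
Proof.
apply/bideg_leP => m; rewrite msuppC; case: ifP => // _; rewrite inE => /eqP ->.
by rewrite /ldeg /rdeg !big1 // => i _; rewrite mnm0E.
Qed.

Lemma bideg_le1 : bideg_le 0 0 1.
Proof. exact: bideg_leC. Qed.

Lemma bideg_leX a b p k : bideg_le a b p -> bideg_le (k * a) (k * b) (p ^+ k).
Proof.
move=> bp; elim: k => [|k IHk]; first exact: bideg_le1.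
by rewrite exprS !mulSn; apply: bideg_leM.
Qed.

Lemma bideg_le_lvar i : bideg_le 1 0 'X_(lshift q i).
Proof.
apply/bideg_leP => m; rewrite msuppX inE => /eqP ->; rewrite /ldeg /rdeg; split.
  rewrite (bigD1 i) //= mnm1E eqxx big1 // => j ji.
  by rewrite mnm1E eq_lshift eq_sym (negPf ji).
by rewrite big1 // => j _; rewrite mnm1E eq_lrshift.
Qed.

Lemma bideg_le_rvar i : bideg_le 0 1 'X_(rshift q i).
Proof.
apply/bideg_leP => m; rewrite msuppX inE => /eqP ->; rewrite /ldeg /rdeg; split.
  by rewrite big1 // => j _; rewrite mnm1E eq_rlshift.
rewrite (bigD1 i) //= mnm1E eqxx big1 // => j ji.
by rewrite mnm1E eq_rshift eq_sym (negPf ji).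
Qed.

Lemma bideg_le_genu j : bideg_le 1 0 (genu A q 0 j).
Proof.
rewrite mxE; case: unlift => [i|]; first exact: bideg_le_lvar.
exact: bideg_leW bideg_le1 _ _.
Qed.

Lemma bideg_le_genv j : bideg_le 0 1 (genv A q 0 j).
Proof.
rewrite mxE; case: unlift => [i|]; first exact: bideg_le_rvar.
exact: bideg_leW bideg_le1 _ _.
Qed.

Lemma bideg_le_theta i : bideg_le 1 1 (theta A i).
Proof.
apply: bideg_leD.
  by apply: bideg_leW (bideg_le_lvar i) _ _.
by rewrite bideg_leN; apply: bideg_leW (bideg_le_rvar i) _ _.
Qed.

Lemma bideg_le_form_var L k : bideg_le 1 1 (form_subst L 'X_k : {mpoly A[q + q]}).
Proof.
rewrite form_substX bformE; apply: bideg_le_sum => i; apply: bideg_le_sum => j.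
apply: (@bideg_leM 1 0 0 1); last exact: bideg_le_genv.
rewrite [X in _ * X]mxE mulrC; apply: (@bideg_leM 0 0 1 0); last exact: bideg_le_genu.
exact: bideg_leC.
Qed.

Lemma bideg_le_form_subst L m :
  bideg_le (mdeg m) (mdeg m) (form_subst L 'X_[m] : {mpoly A[q + q]}).
Proof.
rewrite mpolyXE_id rmorph_prod mdegE.
elim/big_rec2: _ => [|k d p _ bp]; first exact: bideg_le1.
apply: bideg_leM bp; rewrite rmorphXn /=.
by have := bideg_leX (m k) (bideg_le_form_var L k); rewrite muln1.
Qed.

Definition join_mnm (m1 m2 : 'X_{1..q}) : 'X_{1..q + q} :=
  [multinom match split k with inl i => m1 i | inr i => m2 i end | k < q + q].

Lemma join_mnmK m :
  join_mnm [multinom m (lshift q i) | i < q] [multinom m (rshift q i) | i < q] = m.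
Proof.
by apply/mnmP => k; rewrite mnmE -[in RHS](splitK k); case: split => i; rewrite mnmE.
Qed.

Lemma bideg_le_eq0 d p : bideg_le d d p ->
  (forall m1 m2 : 'X_{1..q < d.+1}, p@_(join_mnm m1 m2) = 0) -> p = 0.
Proof.
move=> /bideg_leP bp p0; apply/mpolyP => m; rewrite mcoeff0.
have [/bp[lm rm]|/memN_msupp_eq0//] := boolP (m \in msupp p).
have lt1 : (mdeg [multinom m (lshift q i) | i < q] < d.+1)%N.
  by rewrite mdegE ltnS (eq_bigr _ (fun i _ => mnmE _ i)).
have lt2 : (mdeg [multinom m (rshift q i) | i < q] < d.+1)%N.
  by rewrite mdegE ltnS (eq_bigr _ (fun i _ => mnmE _ i)).
by rewrite -[RHS](p0 (BMultinom lt1) (BMultinom lt2)) /= join_mnmK.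
Qed.

(** The products of the monomials of degree at most N in the L_k with g and
    with the 'C(2q, q) powers of theta all have bidegree at most (N + c, N + c).
    For N large they outnumber the monomials of that bidegree by bin_growth, so
    they satisfy a linear relation. *)
Lemma form_dependent (L : 'I_(q + q) -> 'M[A]_q.+1) i d g : bideg_le d d g ->
  exists (f : {mpoly A[q + q]}) (P : {poly {mpoly A[q + q]}}),
    [/\ (f != 0) || (P != 0), (size P <= 'C(q + q, q))%N &
        form_subst L f * g = (map_poly (form_subst L) P).[theta A i]].
Proof.
move=> bg; set n := 'C(q + q, q).
(* c bounds the bidegree of g and of the powers of theta *)
pose c := (d + n)%N.
have [N ltN] := bin_growth q c.
(* the multipliers: the powers of theta, and g in the last place *)
pose e (k : nat) : {mpoly A[q + q]} := if k == n then g else theta A i ^+ k.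
pose row (x : 'I_n.+1 * 'X_{1..(q + q) < N.+1}) := form_subst L 'X_[x.2] * e x.1.
have row_le x : bideg_le (N + c) (N + c) (row x).
  case: x => k m; rewrite /row /=.
  apply: (@bideg_leW (mdeg m + c) (mdeg m + c)); rewrite ?leq_add2r -1?ltnS ?bmdeg //.
  apply: bideg_leM (bideg_le_form_subst _ _) _; rewrite /e; case: eqP => _.
    by apply: bideg_leW bg _ _; rewrite leq_addr.
  apply: bideg_leW (bideg_leX k (bideg_le_theta i)) _ _; rewrite muln1.
    by rewrite -ltnS (leq_trans (ltn_ord k)) // ltnS leq_addl.
  by rewrite -ltnS (leq_trans (ltn_ord k)) // ltnS leq_addl.
have [|v [[k0 m0] v0] vE] := @underdetermined_system A
  ('I_n.+1 * 'X_{1..(q + q) < N.+1})%type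
  ('X_{1..q < (N + c).+1} * 'X_{1..q < (N + c).+1})%type
  (fun x y => (row x)@_(join_mnm y.1 y.2)).
  rewrite !card_prod !card_bmultinom card_ord mulnn.
  by rewrite addnC [X in (_ < _ * 'C(X, _))%N]addnC.
pose f (k : 'I_n.+1) : {mpoly A[q + q]} :=
  \sum_(m : 'X_{1..(q + q) < N.+1}) v (k, m) *: 'X_[m].
have f0 : f k0 != 0.
  apply: contraNneq v0 => /(congr1 (mcoeff m0)); rewrite raddf_sum mcoeff0 /=.
  rewrite (bigD1 m0) //= mcoeffZ mcoeffX eqxx mulr1 big1 ?addr0 => [->//|m mm0].
  by rewrite mcoeffZ mcoeffX -bmeqP (negPf mm0) mulr0.
have rel : \sum_(k < n.+1) form_subst L (f k) * e k = 0.
  transitivity (\sum_x v x *: row x).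
    rewrite (eq_bigr (fun x => v (x.1, x.2) *: row (x.1, x.2))) => [|[] //].
    rewrite -(pair_bigA _ (fun k (m : 'X_{1..(q + q) < N.+1}) =>
      v (k, m) *: row (k, m))) /=.
    apply: eq_bigr => k _.
    rewrite raddf_sum mulr_suml; apply: eq_bigr => m _.
    by rewrite /= form_substZ scalerAl.
  apply: (@bideg_le_eq0 (N + c)) => [|m1 m2].
    by apply: bideg_le_sum => x; apply: bideg_leZ.
  rewrite raddf_sum -[RHS](vE (m1, m2)); apply: eq_bigr => x _.
  by rewrite /= mcoeffZ.
exists (f ord_max), (- \poly_(k < n) f (inord k)); split.
- case: (unliftP ord_max k0) => [j jk|<-]; last by rewrite f0.
  rewrite oppr_eq0 orbC; apply/orP; left; apply: contraNneq f0.
  move/(congr1 (fun P : {poly _} => P`_j)); rewrite coef0 coef_poly ltn_ord.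
  move=> E; rewrite -[X in _ == X]E jk; apply/eqP; congr f.
  by apply: ord_inj; rewrite lift_max inordK // ltnS ltnW.
- by rewrite size_polyN size_poly.
move: rel; rewrite big_ord_recr /= {2}/e eqxx addrC => /eqP.
rewrite addr_eq0 => /eqP ->; rewrite rmorphN hornerN; congr (- _).
rewrite poly_def rmorph_sum horner_sum; apply: eq_bigr => k _ /=.
rewrite map_polyZ map_polyXn hornerZ hornerXn /e ltn_eqF //.
by congr (form_subst L (f _) * _); apply: ord_inj; rewrite inordK // ltnS ltnW.
Qed.

End Bidegree.

(** * Elimination: the parity of theta *)
Section Elimination.

Variables (T C : idomainType) (Phi : {rmorphism T -> C}).
Variables (sigma : {rmorphism C -> C}) (theta : C) (D : nat).
Hypothesis sigma_Phi : forall t, sigma (Phi t) = Phi t.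
Hypothesis sigma_theta : sigma theta = - theta.
Hypothesis two : 2%:R != 0 :> C.
Hypothesis indep : forall P : {poly T},
  (size P <= D.*2)%N -> (map_poly Phi P).[theta] = 0 -> P = 0.

(** Over the fraction field of T, g is a combination of the powers of theta
    below theta^(2D), with the denominator f cleared. *)
Definition reducible (g : C) := exists (f : T) (P : {poly T}),
  [/\ f != 0, (size P <= D.*2)%N & Phi f * g = (map_poly Phi P).[theta]].

(* Polynomials over T are evaluated at theta^2, which sigma fixes. *)
Let ev : {rmorphism {poly T} -> C} :=
  horner_eval (theta ^+ 2) \o map_poly Phi.

Let evE P : ev P = (map_poly Phi P).[theta ^+ 2]. Proof. by []. Qed.

Let evC t : ev t%:P = Phi t.
Proof. by rewrite evE map_polyC hornerC. Qed.

Let horner_theta P :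
  (map_poly Phi P).[theta] = ev (even_poly P) + theta * ev (odd_poly P).
Proof.
rewrite -{1}[P]poly_even_odd rmorphD rmorphM /= !map_comp_poly map_polyX map_polyXn.
by rewrite hornerD hornerMX !horner_comp hornerXn mulrC.
Qed.

Let sigma_ev P : sigma (ev P) = ev P.
Proof.
rewrite evE -horner_map -map_poly_comp rmorphXn sigma_theta sqrrN.
by congr (horner _ _); apply: eq_map_poly => t /=; rewrite sigma_Phi.
Qed.

Let indep2 (K : {poly T}) : (size K <= D)%N -> ev K = 0 -> K = 0.
Proof.
have [-> //|nzK] := eqVneq K 0; rewrite -size_poly_gt0 in nzK.
move=> sK K0; have Kc0 : K \Po 'X^2 = 0.
  apply: indep; last by rewrite map_comp_poly map_polyXn horner_comp hornerXn.
  apply: leq_trans (leqSpred _) _; rewrite size_comp_poly size_polyXn muln2.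
  by rewrite -(prednK nzK) in sK; rewrite -ltnS ltnW // ltnS -doubleS leq_double.
apply/polyP => i; have := congr1 (fun p : {poly T} => p`_(i * 2)) Kc0.
by rewrite coef_comp_poly_Xn // dvdn_mull // mulnK // !coef0.
Qed.

(** The polynomial of degree 2D that kills theta also kills sigma theta =
    - theta, hence so does its even part, which is a polynomial of degree D in
    theta^2. *)
Lemma even_annihilator : reducible (theta ^+ D.*2) ->
  exists2 G : {poly T}, size G = D.+1 & ev G = 0.
Proof.
move=> [f [P [f0 sP E]]]; pose F := f *: 'X^(D.*2) - P.
have sF : size F = D.*2.+1.
  rewrite size_polyDl ?size_scale ?size_polyXn // size_polyN.
  by rewrite ltnS.
have Fth : (map_poly Phi F).[theta] = 0.
  by rewrite rmorphB /= map_polyZ map_polyXn hornerD hornerN hornerZ hornerXn E subrr.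
exists (even_poly F).
  by rewrite size_even_poly_eq sF /= ?odd_double // doubleK.
have := congr1 sigma Fth; rewrite horner_theta rmorphD rmorphM !sigma_ev sigma_theta.
rewrite rmorph0; move: Fth; rewrite horner_theta => E1 E2.
have : 2%:R * ev (even_poly F) = 0.
  by rewrite -[RHS]addr0 -{1}E1 -E2; ring.
by move/eqP; rewrite mulf_eq0 (negPf two) => /eqP.
Qed.

(** G plays the role of the minimal polynomial of theta^2: the remainder of a
    pseudo-division by G has degree below D and vanishes at theta^2, hence is
    0. *)
Lemma annihilator_dvd (G K : {poly T}) : size G = D.+1 -> ev G = 0 -> ev K = 0 ->
  exists e Q, e != 0 /\ e *: K = Q * G.
Proof.
move=> sG G0 K0; have nzG : G != 0 by rewrite -size_poly_gt0 sG.
exists (lead_coef G ^+ scalp K G), (K %/ G); split.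
  by rewrite expf_neq0 ?lead_coef_eq0.
rewrite Pdiv.Idomain.divp_eq; suff -> : K %% G = 0 by rewrite addr0.
apply: indep2; first by rewrite -ltnS -sG ltn_modp.
have := congr1 ev (Pdiv.Idomain.divp_eq K G).
rewrite -mul_polyC rmorphD !rmorphM K0 G0 !mulr0 add0r.
by move/esym.
Qed.

Lemma common_denominator n (U : 'rV[C]_n) : (forall j, reducible (U 0 j)) ->
  exists f (P : 'I_n -> {poly T}), [/\ f != 0, forall j, (size (P j) <= D.*2)%N &
    forall j, Phi f * U 0 j = (map_poly Phi (P j)).[theta]].
Proof.
move=> /fin_all_exists[f /fin_all_exists[P fP]].
exists (\prod_j f j), (fun j => (\prod_(i | i != j) f i) *: P j); split=> [|j|j].
- by apply/prodf_neq0 => j _; have [] := fP j.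
- by have [_ sP _] := fP j; apply: leq_trans (size_scale_leq _ _) sP.
have [_ _ E] := fP j; rewrite map_polyZ hornerZ -E mulrA; congr (_ * _).
by rewrite (bigD1 j) //= rmorphM mulrC.
Qed.

(** Splitting into even and odd parts, f U = a + theta c and, applying sigma,
    f V = a - theta c, where a and c are polynomials in theta^2.  As L k is
    symmetric, the equations for (U, V) only involve theta^2, so they hold
    modulo G up to a denominator e.  A coordinate equal to 1 in U keeps this
    value, which later prevents the specialised vectors from being 0. *)
Lemma elimination n (I : Type) (L : I -> 'M[T]_n) (y : I -> T) (U V : 'rV[C]_n) :
  (forall k, (L k)^T = L k) -> map_mx sigma U = V ->
  reducible (theta ^+ D.*2) -> (forall j, reducible (U 0 j)) ->
  (forall k, Phi (y k) = bform (map_mx Phi (L k)) U V) -> (0 < D)%N ->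
  exists f (G : {poly T}) (a c : 'rV[{poly T}]_n),
  [/\ f != 0, size G = D.+1,
    forall j, U 0 j = 1 -> a 0 j = f%:P /\ c 0 j = 0 &
    forall k, exists e Q, e != 0 /\
      e *: (bform (map_mx polyC (L k)) a a - 'X * bform (map_mx polyC (L k)) c c
            - (f ^+ 2 * y k)%:P) = Q * G].
Proof.
move=> symL UV /even_annihilator[G sG G0] /common_denominator[f [P [f0 sP fU]]] yE D0.
exists f, G, (\row_j even_poly (P j)), (\row_j odd_poly (P j)); split=> // [j Uj|k].
  rewrite !mxE; have -> : P j = f%:P.
    apply/eqP; rewrite -subr_eq0; apply/eqP/indep.
      rewrite (leq_trans (size_polyD _ _)) // geq_max sP size_polyN.
      by rewrite (leq_trans (size_polyC_leq1 _)) // double_gt0.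
    by rewrite rmorphB /= map_polyC hornerD hornerN hornerC -fU Uj mulr1 subrr.
  by rewrite even_polyC odd_polyC.
apply: annihilator_dvd => //; set a := \row__ _; set c := \row__ _.
have MC : map_mx ev (map_mx polyC (L k)) = map_mx Phi (L k).
  by apply/matrixP => i j; rewrite !mxE evC.
rewrite !rmorphB rmorphM !bform_map !MC !evC rmorphM rmorphXn yE.
rewrite evE map_polyX hornerX; set a' := map_mx ev a; set c' := map_mx ev c.
have fUE : Phi f *: U = a' + theta *: c'.
  by apply/rowP => j; rewrite !mxE fU horner_theta.
have fVE : Phi f *: V = a' - theta *: c'.
  apply/rowP => j; rewrite -UV; have := congr1 (fun w : 'rV[C]_n => sigma (w 0 j)) fUE.
  by rewrite !mxE rmorphM sigma_Phi rmorphD rmorphM !sigma_ev sigma_theta mulNr.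
have symP : (map_mx Phi (L k))^T = map_mx Phi (L k) by rewrite matrix.map_trmx symL.
rewrite (expr2 (Phi f)) -mulrA -(bformZr _ (Phi f)) -(bformZl _ (Phi f)).
rewrite fUE fVE bform_conjugate //.
by rewrite subrr.
Qed.

End Elimination.

(** * Real points of the deformed system *)
Section Swap.
Import mpoly.
Variables (A : comNzRingType) (q : nat).

Definition swap_ord (k : 'I_(q + q)) : 'I_(q + q) :=
  match split k with inl i => rshift q i | inr i => lshift q i end.

Definition swap_vars : {rmorphism {mpoly A[q + q]} -> {mpoly A[q + q]}} :=
  comp_mpoly [tuple 'X_(swap_ord k) | k < q + q].

Lemma swap_varsC c : swap_vars c%:MP = c%:MP.
Proof. exact: comp_mpolyC. Qed.

Lemma swap_varsX k : swap_vars 'X_k = 'X_(swap_ord k).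
Proof. by rewrite /swap_vars /= comp_mpolyXU nth_mktuple. Qed.

Lemma swap_ordl i : swap_ord (lshift q i) = rshift q i.
Proof. by rewrite /swap_ord (unsplitK (inl i : 'I_q + 'I_q)). Qed.

Lemma swap_ordr i : swap_ord (rshift q i) = lshift q i.
Proof. by rewrite /swap_ord (unsplitK (inr i : 'I_q + 'I_q)). Qed.

Lemma swap_genu : map_mx swap_vars (genu A q) = genv A q.
Proof.
apply/rowP => j; rewrite !mxE; case: unlift => [i|]; last exact: rmorph1.
by rewrite swap_varsX swap_ordl.
Qed.

Lemma swap_genv : map_mx swap_vars (genv A q) = genu A q.
Proof.
apply/rowP => j; rewrite !mxE; case: unlift => [i|]; last exact: rmorph1.
by rewrite swap_varsX swap_ordr.
Qed.

Lemma swap_theta i : swap_vars (theta A i) = - theta A i.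
Proof. by rewrite rmorphB !swap_varsX swap_ordl swap_ordr opprB. Qed.

Lemma swap_form_subst (L : 'I_(q + q) -> 'M[A]_q.+1) p :
  (forall k, (L k)^T = L k) -> swap_vars (form_subst L p) = form_subst L p.
Proof.
move=> symL; apply: (mpoly_rmorph_ext (f := swap_vars \o form_subst L)
  (g := form_subst L)) => [c|k] /=.
  by rewrite (form_substC L); apply: swap_varsC.
rewrite (form_substX L) (bform_map swap_vars) swap_genu swap_genv.
have -> : map_mx swap_vars (map_mx (@mpolyC _ _) (L k)) = map_mx (@mpolyC _ _) (L k).
  by apply/matrixP => i j; rewrite !mxE swap_varsC.
by rewrite bformC // matrix.map_trmx symL.
Qed.

End Swap.

(** Specialising the coefficients to real numbers keeps the degree of G, which
    is odd, so theta^2 can be given a real value w.  Its square root may be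
    imaginary, but only w occurs in the equations. *)
Lemma specialize_odd (T : idomainType) (R : rcfType) (ep : {rmorphism T -> R})
    n (I : Type) (L : I -> 'M[T]_n) (y : I -> T) (f : T) (G : {poly T})
    (a c : 'rV[{poly T}]_n) (D : nat) (e : I -> T) (Q : I -> {poly T}) :
  odd D -> size G = D.+1 -> ep f != 0 -> ep (lead_coef G) != 0 ->
  (forall k, ep (e k) != 0) ->
  (forall k, e k *: (bform (map_mx polyC (L k)) a a
      - 'X * bform (map_mx polyC (L k)) c c - (f ^+ 2 * y k)%:P) = Q k * G) ->
  exists w (a' c' : 'rV[R]_n),
    [/\ forall j, a 0 j = f%:P -> a' 0 j = 1, forall j, c 0 j = 0 -> c' 0 j = 0 &
      forall k, bform (map_mx ep (L k)) a' a' - w * bform (map_mx ep (L k)) c' c'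
                = ep (y k)].
Proof.
move=> oddD sG epf epG epe eQ.
have sG' : size (map_poly ep G) = D.+1 by rewrite size_map_poly_id0.
have [w /rootP Gw] : {w | root (map_poly ep G) w}.
  by apply: polyrcf.odd_poly_root; rewrite sG' /= negbK.
pose ev : {rmorphism {poly T} -> R} := horner_eval w \o map_poly ep.
have evC u : ev u%:P = ep u by rewrite /ev /= map_polyC /horner_eval hornerC.
have evX : ev 'X = w by rewrite /ev /= map_polyX /horner_eval hornerX.
have evXM u : ev ('X * u) = w * ev u by rewrite rmorphM evX.
have evf k : ev (f ^+ 2 * y k)%:P = ep f ^+ 2 * ep (y k).
  by rewrite evC rmorphM rmorphXn.
have evG : ev G = 0 by exact: Gw.
exists w, ((ep f)^-1 *: map_mx ev a), ((ep f)^-1 *: map_mx ev c); split=> [j aj|j cj|k].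
- by rewrite !mxE aj evC mulVf.
- by rewrite !mxE cj rmorph0 mulr0.
have := congr1 ev (eQ k); rewrite [RHS]rmorphM evG mulr0.
rewrite -mul_polyC (rmorphM ev) evC => /eqP; rewrite mulf_eq0 (negPf (epe k)) orFb.
rewrite !(rmorphB ev) evXM evf !bform_map.
have -> : map_mx ev (map_mx polyC (L k)) = map_mx ep (L k).
  by apply/matrixP => i j; rewrite !mxE evC.
rewrite subr_eq0 => /eqP E; rewrite !bformZl !bformZr.
rewrite -[RHS]mul1r -(expr1n _ 2) -(mulVf epf) exprMn -[RHS]mulrA -E; ring.
Qed.

Section RealPoints.
Import mpoly.
Variables (R : rcfType) (q D : nat) (B : 'I_(q + q) -> 'M[R]_q.+1).
Hypothesis symB : forall k, (B k)^T = B k.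
Hypothesis q0 : (0 < q)%N.
Hypothesis binD : 'C(q + q, q) = D.*2.
Hypothesis oddD : odd D.

Let L (k : 'I_(q + q)) : 'M[{poly R}]_q.+1 :=
  'X *: map_mx polyC (B k) + coefform _ q k.

Let symL k : (L k)^T = L k.
Proof.
rewrite /L linearD linearZ /= matrix.map_trmx symB; congr (_ + _).
by apply/matrixP => i j; rewrite !mxE addnC.
Qed.

Let Ls s k : map_mx (horner_eval s) (L k) = s *: B k + coefform R q k.
Proof.
rewrite -(map_coefform (horner_eval s)) /L map_mxD; congr (_ + _).
by apply/matrixP => i j; rewrite !mxE /= /horner_eval hornerM hornerX hornerC.
Qed.

Let L0 k : map_mx (horner_eval 0) (L k) = coefform R q k.
Proof. by rewrite Ls scale0r add0r. Qed.

Let i0 : 'I_q := Ordinal (eq_leq (prednK q0)).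

Let i0S : i0.+1 = q. Proof. exact: prednK. Qed.

Let two : 2%:R != 0 :> R. Proof. by rewrite pnatr_eq0. Qed.

Let indep (P : {poly {mpoly {poly R}[q + q]}}) : (size P <= D.*2)%N ->
  (map_poly (form_subst L) P).[theta _ i0] = 0 -> P = 0.
Proof. by rewrite -binD; apply: form_independent. Qed.

Let bideg_reducible d g : bideg_le d d g ->
  reducible (form_subst L) (theta _ i0) D g.
Proof.
move=> /(form_dependent L i0)[f [P [nz sP E]]]; exists f, P.
rewrite -binD; split=> //; apply/eqP => f0; move: nz; rewrite f0 eqxx /=.
case/eqP; apply: indep; first by rewrite -binD.
by rewrite -E f0 rmorph0 mul0r.
Qed.

(** The point where the data of the elimination are specialised only has to
    avoid the zeros of one polynomial z in t and s.  Fixing t first, so that z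
    remains a nonzero polynomial in s, leaves all but finitely many s: the
    same t serves for arbitrarily large s. *)
Lemma deformed_real_points : exists t : 'I_(q + q) -> R, forall S : R,
  exists s w (a c : 'rV[R]_q.+1), [/\ S <= s, a 0 ord_max = 1, c 0 ord_max = 0 &
    forall k, let M := s *: B k + coefform R q k in
      bform M a a - w * bform M c c = t k].
Proof.
have D0 : (0 < D)%N by rewrite -double_gt0 -binD bin_gt0 leq_addr.
have red_theta : reducible (form_subst L) (theta _ i0) D (theta _ i0 ^+ D.*2).
  apply: (bideg_reducible (d := D.*2)).
  by have := bideg_leX D.*2 (bideg_le_theta {poly R} i0); rewrite muln1.
have red_genu j : reducible (form_subst L) (theta _ i0) D (genu {poly R} q 0 j).
  by apply: (bideg_reducible (d := 1)); apply: bideg_leW (bideg_le_genu _ j) _ _.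
have nz2 : 2%:R != 0 :> {mpoly {poly R}[q + q]}.
  by rewrite -mpolyC_nat mpolyC_eq0 -polyC_natr polyC_eq0.
have symLC k : (map_mx (@mpolyC (q + q) _) (L k))^T = map_mx (@mpolyC _ _) (L k).
  by rewrite matrix.map_trmx symL.
have formE k : form_subst L 'X_k =
    bform (map_mx (form_subst L) (map_mx (@mpolyC _ _) (L k))) (genu _ q) (genv _ q).
  rewrite form_substX; congr (bform _ (genu _ q) (genv _ q)).
  by apply/matrixP => i j; rewrite !mxE form_substC.
have [f [G [a [c [f0 sG aE /fin_all_exists[e /fin_all_exists[Q eQ]]]]]]] :=
  elimination (fun t => swap_form_subst t symL) (swap_theta _ i0) nz2 indep
    symLC (swap_genu _ q) red_theta red_genu formE D0.
have [aM cM] : a 0 ord_max = f%:P /\ c 0 ord_max = 0.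
  by apply: aE; rewrite mxE unlift_none.
pose z := f * lead_coef G * \prod_k e k.
have nzz : z != 0.
  rewrite !mulf_neq0 // ?lead_coef_eq0 -?size_poly_gt0 ?sG //.
  by apply/prodf_neq0 => k _; have [] := eQ k.
have [x [b nzx]] : exists x b, z.@[fun i => (x%:R%:P : {poly R}) ^+ (b ^ i)] != 0.
  apply: (mpoly_nonroot (c := fun x => x%:R%:P)) => // y1 y2 /polyC_inj/eqP.
  by rewrite eqr_nat => /eqP.
exists (fun k => x%:R ^+ (b ^ k)) => S.
have [|y nzy] := poly_nonroot (c := fun y : nat => S + y%:R) _ nzx.
  by move=> y1 y2 /addrI/eqP; rewrite eqr_nat => /eqP.
set s := S + y%:R in nzy.
pose ep : {rmorphism {mpoly {poly R}[q + q]} -> R} :=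
  horner_eval s \o meval (fun i => (x%:R%:P : {poly R}) ^+ (b ^ i)).
have epC u : ep u%:MP = u.[s] by rewrite /ep /= mevalC.
have epX k : ep 'X_k = x%:R ^+ (b ^ k).
  by rewrite /ep /= mevalXU /horner_eval -rmorphXn hornerC.
have epz : ep z != 0 by exact: nzy.
have [epf epG epe] : [/\ ep f != 0, ep (lead_coef G) != 0 & forall k, ep (e k) != 0].
  move: epz; rewrite /z !rmorphM rmorph_prod !mulf_eq0 !negb_or.
  by move=> /andP[/andP[-> ->] /prodf_neq0 ep_e]; split=> // k; apply: ep_e.
have [w [a' [c' [aE' cE' formE']]]] :=
  specialize_odd oddD sG epf epG epe (fun k => (eQ k).2).
exists s, w, a', c'; split=> [|||k].
- by rewrite lerDl.
- exact: aE'.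
- exact: cE'.
rewrite /= -Ls -epX -formE'.
have -> : map_mx ep (map_mx (@mpolyC _ _) (L k)) = map_mx (horner_eval s) (L k).
  by apply/matrixP => i j; rewrite !mxE epC.
by [].
Qed.

End RealPoints.

(** * Letting the deformation parameter tend to infinity *)
Section Compactness.
Import boolp classical_sets functions topology normedtype derive.
Import numFieldNormedType.Exports.
Local Open Scope classical_set_scope.
Variables (R : realType) (n : nat).
Implicit Types (x y : 'rV[R]_n.+1).

Lemma coord_le_norm x i : `|x 0 i| <= `|x|.
Proof.
rewrite [leRHS]/Num.Def.normr /= mx_normrE.
by apply/bigmax_geP; right; exists (0, i).
Qed.

Definition bform_size (M : 'M[R]_n.+1) : R := \sum_i \sum_j `|M i j|.

Lemma bform_le M x y : `|bform M x y| <= bform_size M * (`|x| * `|y|).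
Proof.
rewrite bformE mulr_suml; apply: le_trans (ler_norm_sum _ _ _) _.
apply: ler_sum => i _; rewrite mulr_suml; apply: le_trans (ler_norm_sum _ _ _) _.
apply: ler_sum => j _; rewrite !normrM mulrAC [leRHS]mulrC.
by apply: ler_wpM2r; rewrite ?ler_pM ?coord_le_norm.
Qed.

Lemma continuous_sum_seq (T : topologicalType) (I : Type) (r : seq I) (f : I -> T -> R) :
  (forall i, continuous (f i)) -> continuous (fun z => \sum_(i <- r) f i z).
Proof.
move=> fc; elim: r => [|i r IHr].
  have -> : (fun z => \sum_(i <- [::]) f i z) = cst 0.
    by apply/funext => z; rewrite big_nil.
  exact: cst_continuous.
have -> : (fun z => \sum_(j <- i :: r) f j z) = f i \+ (fun z => \sum_(j <- r) f j z).
  by apply/funext => z; rewrite big_cons.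
by move=> z; apply: continuousD; [exact: fc | exact: IHr].
Qed.

Lemma bform_continuous M :
  continuous (fun z : 'rV[R]_n.+1 * 'rV[R]_n.+1 => bform M z.1 z.2).
Proof.
have -> : (fun z : 'rV[R]_n.+1 * 'rV[R]_n.+1 => bform M z.1 z.2) =
    (fun z => \sum_i \sum_j z.1 0 i * M i j * z.2 0 j).
  by apply/funext => z; rewrite bformE.
apply: continuous_sum_seq => i; apply: continuous_sum_seq => j.
have c1 : continuous (fun z : 'rV[R]_n.+1 * 'rV[R]_n.+1 => z.1 0 i).
  move=> z; apply: (@continuous_comp _ _ _ fst (fun x : 'rV[R]_n.+1 => x 0 i)).
    exact: cvg_fst.
  exact: coord_continuous.
have c2 : continuous (fun z : 'rV[R]_n.+1 * 'rV[R]_n.+1 => z.2 0 j).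
  move=> z; apply: (@continuous_comp _ _ _ snd (fun x : 'rV[R]_n.+1 => x 0 j)).
    exact: cvg_snd.
  exact: coord_continuous.
by move=> z; exact: (cvgM (cvgM (c1 z) (cvg_cst (M i j))) (c2 z)).
Qed.

Let sphere : set 'rV[R]_n.+1 := [set x | `|x| = 1].

Let sphere_compact : compact sphere.
Proof.
apply: bounded_closed_compact.
  by exists 1; split=> // M ltM x /= ->; apply: ltW.
have -> : sphere = Num.norm @^-1` [set 1%R] by [].
apply: preimage_closed; last exact: closed_eq.
by move=> x _; exact: norm_continuous.
Qed.

Let normalize x : x != 0 -> sphere (`|x|^-1 *: x).
Proof.
by move=> x0; rewrite /sphere /= normrZ normfV normr_id mulVf // normr_eq0.
Qed.

(** The minimum over the compact product of two unit spheres is positive, and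
    both sides are homogeneous of degree 1 in x and in y. *)
Lemma definite_pair_bound (I : finType) (B : I -> 'M[R]_n.+1) :
  (forall x y, x != 0 -> y != 0 -> exists k, bform (B k) x y != 0) ->
  exists2 d, 0 < d & forall x y,
    d * (`|x| * `|y|) <= \sum_k `|bform (B k) x y|.
Proof.
move=> defB; pose f (z : 'rV[R]_n.+1 * 'rV[R]_n.+1) := \sum_k `|bform (B k) z.1 z.2|.
have fc : continuous f.
  apply: continuous_sum_seq => k z.
  apply: (@continuous_comp _ _ _ (fun z => bform (B k) z.1 z.2)) => //.
    exact: bform_continuous.
  exact: norm_continuous.
have [s0 Ss0] : sphere !=set0.
  exists (`|const_mx 1 : 'rV[R]_n.+1|^-1 *: const_mx 1); apply: normalize.
  by apply/rV0Pn; exists 0; rewrite mxE oner_eq0.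
have [||[a b] + minf] := compact_EVT_min _
    (compact_setX sphere_compact sphere_compact) (f := f).
- by exists (s0, s0).
- exact: continuous_subspaceT.
rewrite inE => -[/= Sa Sb].
have nz x : sphere x -> x != 0.
  by rewrite /sphere /= => x1; rewrite -normr_eq0 x1 oner_eq0.
exists (f (a, b)) => [|x y].
  have [k Bk] := defB a b (nz _ Sa) (nz _ Sb).
  rewrite /f (bigD1 k) //= ltr_wpDr ?normr_gt0 //.
  by apply: sumr_ge0 => *; apply: normr_ge0.
have [->|x0] := eqVneq x 0; first by rewrite normr0 mul0r mulr0 sumr_ge0.
have [->|y0] := eqVneq y 0; first by rewrite normr0 !mulr0 sumr_ge0.
have := minf (`|x|^-1 *: x, `|y|^-1 *: y).
rewrite inE => /(_ (conj (normalize x0) (normalize y0))).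
rewrite -ler_pdivlMr ?mulr_gt0 ?normr_gt0 // => /le_trans; apply.
rewrite /f mulr_suml; apply: ler_sum => k _ /=.
rewrite bformZl bformZr !normrM !normfV !normr_id invfM.
by rewrite mulrA [leLHS]mulrC.
Qed.

Lemma definite_bound (M : 'M[R]_n.+1) : (forall x, x != 0 -> 0 < bform M x x) ->
  exists2 d, 0 < d & forall x, d * `|x| ^+ 2 <= bform M x x.
Proof.
move=> posM; pose f x := bform M x x.
have fc : continuous f.
  move=> x; apply: (@continuous_comp _ _ _ (fun x => (x, x))
    (fun z : 'rV[R]_n.+1 * 'rV[R]_n.+1 => bform M z.1 z.2)).
    exact: (cvg_pair (@cvg_id _ (nbhs x)) (@cvg_id _ (nbhs x))).
  exact: bform_continuous.
have [s0 Ss0] : sphere !=set0.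
  exists (`|const_mx 1 : 'rV[R]_n.+1|^-1 *: const_mx 1); apply: normalize.
  by apply/rV0Pn; exists 0; rewrite mxE oner_eq0.
have [||a + minf] := compact_EVT_min _ sphere_compact (f := f).
- by exists s0.
- exact: continuous_subspaceT.
rewrite inE /sphere /= => Sa; exists (f a) => [|x].
  by apply: posM; rewrite -normr_eq0 Sa oner_eq0.
have [->|x0] := eqVneq x 0.
  by rewrite normr0 expr0n mulr0 /bform !mul0mx mxE.
have := minf (`|x|^-1 *: x); rewrite inE => /(_ (normalize x0)).
rewrite /f bformZl bformZr mulrA -expr2 exprVn mulrC ler_pdivlMr //.
by rewrite exprn_gt0 // normr_gt0.
Qed.

End Compactness.

Section Limit.
Import normedtype.
Import numFieldNormedType.Exports.
Variables (R : realType) (n : nat) (I : finType).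
Implicit Types (x y : 'rV[R]_n.+1) (k : I).

Lemma bform_deform (M N : 'M[R]_n.+1) s x y :
  bform (s *: M + N) x y = s * bform M x y + bform N x y.
Proof.
by rewrite /bform mulmxDr mulmxDl -scalemxAr -scalemxAl !mxE.
Qed.

Lemma bform_sum (B : I -> 'M[R]_n.+1) x y :
  bform (\sum_k B k) x y = \sum_k bform (B k) x y.
Proof. by rewrite /bform mulmx_sumr mulmx_suml summxE. Qed.

Lemma norm_ge1 x : x 0 ord_max = 1 -> 1 <= `|x|.
Proof. by move=> x1; have := coord_le_norm x ord_max; rewrite x1 normr1. Qed.

(** A solution is turned into the pair u, v = a +- sqrt w c if w >= 0, and into
    a + i b, a - i b with b = sqrt (- w) c otherwise.  Since a and c have last
    coordinates 1 and 0, the norms of u, v and a are at least 1, so t_k and E_k are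
    bounded by a constant times the product (resp. the squares) of the norms,
    whereas the definiteness of the B_k makes s * B_k exceed this for s large. *)
Lemma no_points_far (B E : I -> 'M[R]_n.+1) (t : I -> R) :
  (forall k, (B k)^T = B k) -> (forall k, (E k)^T = E k) ->
  (forall x y, x != 0 -> y != 0 -> exists k, bform (B k) x y != 0) ->
  (forall x, x != 0 -> 0 < bform (\sum_k B k) x x) ->
  exists S : R, forall s w (a c : 'rV[R]_n.+1),
    S <= s -> a 0 ord_max = 1 -> c 0 ord_max = 0 ->
    ~ (forall k, bform (s *: B k + E k) a a - w * bform (s *: B k + E k) c c = t k).
Proof.
move=> symB symE /definite_pair_bound[d1 d1_gt0 boundB].
move=> /definite_bound[d2 d2_gt0 boundS].
pose tau := \sum_k `|t k|; pose CE := \sum_k bform_size (E k).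
have tau_ge0 : 0 <= tau by apply: sumr_ge0.
have CE_ge0 : 0 <= CE.
  by apply: sumr_ge0 => k _; apply: sumr_ge0 => i _; apply: sumr_ge0.
have E_le x y : \sum_k `|bform (E k) x y| <= CE * (`|x| * `|y|).
  by rewrite mulr_suml; apply: ler_sum => k _; apply: bform_le.
have symM s k : (s *: B k + E k)^T = s *: B k + E k.
  by rewrite linearD linearZ /= symB symE.
exists ((tau + CE + 1) / d1 + (tau + CE + 1) / d2) => s w a c leSs a1 c0 eqt.
have s1 : tau + CE < s * d1.
  rewrite -ltr_pdivrMr //; apply: lt_le_trans leSs.
  rewrite -[ltLHS]addr0 ler_ltD ?divr_gt0 //; last by lra.
  by rewrite ler_pM2r ?invr_gt0 //; lra.
have s2 : tau + CE < s * d2.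
  rewrite -ltr_pdivrMr //; apply: lt_le_trans leSs.
  rewrite -[ltLHS]add0r ltr_leD ?divr_gt0 //; first by lra.
  by rewrite ler_pM2r ?invr_gt0 //; lra.
have s_ge0 : 0 <= s by rewrite -(pmulr_lge0 _ d1_gt0); lra.
have [w0|w0] := lerP 0 w.
  pose r := Num.sqrt w; pose u := a + r *: c; pose v := a - r *: c.
  have u1 : 1 <= `|u| by apply: norm_ge1; rewrite !mxE a1 c0 mulr0 addr0.
  have v1 : 1 <= `|v| by apply: norm_ge1; rewrite !mxE a1 c0 mulr0 subr0.
  have uv1 : 1 <= `|u| * `|v| by nra.
  have suv k : s * `|bform (B k) u v| <= `|t k| + `|bform (E k) u v|.
    rewrite -[s in leLHS]ger0_norm // -normrM.
    have -> : s * bform (B k) u v = t k - bform (E k) u v.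
      rewrite -(eqt k) -[w in RHS](sqr_sqrtr w0) -bform_conjugate //.
      by rewrite bform_deform addrK.
    exact: ler_normB.
  have : s * (d1 * (`|u| * `|v|)) <= tau + CE * (`|u| * `|v|).
    apply: le_trans (ler_wpM2l s_ge0 (boundB u v)) _; rewrite mulr_sumr.
    apply: le_trans (ler_sum _ (fun k _ => suv k)) _.
    by rewrite big_split lerD2l E_le.
  by apply/negP; rewrite -ltNge; nra.
pose r := Num.sqrt (- w); pose b := r *: c.
have na : 1 <= `|a| by exact: norm_ge1.
have nb : 0 <= `|b| by [].
have : s * (bform (\sum_k B k) a a + bform (\sum_k B k) b b)
    <= tau + CE * (`|a| * `|a| + `|b| * `|b|).
  rewrite !bform_sum -big_split mulr_sumr /=.
  have sab k : s * (bform (B k) a a + bform (B k) b b)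
      <= `|t k| + `|bform (E k) a a| + `|bform (E k) b b|.
    have -> : s * (bform (B k) a a + bform (B k) b b)
        = t k - bform (E k) a a - bform (E k) b b.
      rewrite -(eqt k) !bform_deform /b !bformZl !bformZr.
      have -> : w = - r ^+ 2 by rewrite sqr_sqrtr ?opprK // oppr_ge0 ltW.
      ring.
    by rewrite !lerD // ?ler_norm // -normrN ler_norm.
  apply: le_trans (ler_sum _ (fun k _ => sab k)) _.
  by rewrite !big_split /= -addrA lerD2l mulrDr lerD ?E_le.
apply/negP; rewrite -ltNge.
have Sa := boundS a; have Sb := boundS b.
apply: (@lt_le_trans _ _ (s * (d2 * `|a| ^+ 2 + d2 * `|b| ^+ 2))); last first.
  by apply: ler_wpM2l => //; apply: lerD.
have : 1 <= `|a| ^+ 2 + `|b| ^+ 2 by nra.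
rewrite -mulrDr -!expr2 mulrA; set X := _ + _ => X1; nra.
Qed.

End Limit.

(** * Forms attached to orthogonal projections *)
Section Projections.
Import boolp.
Variables (R : realType) (n : nat).
Implicit Types (W : {vspace 'rV[R]_n}) (x y : 'rV[R]_n).

Definition proj_gram W : 'M[R]_n :=
  lin1_mx (oproj W) *m (lin1_mx (oproj W))^T.

Lemma proj_gramT W : (proj_gram W)^T = proj_gram W.
Proof. by rewrite /proj_gram trmx_mul trmxK. Qed.

Lemma bform_proj_gram W x y : bform (proj_gram W) x y = dotv (oproj W x) (oproj W y).
Proof.
rewrite /bform /proj_gram mulmxA -mulmxA -trmx_mul !mul_rV_lin1 mxE.
by apply: eq_bigr => i _; rewrite mxE.
Qed.

Lemma enorm_oproj W x : enorm (oproj W x) = Num.sqrt (bform (proj_gram W) x x).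
Proof. by rewrite bform_proj_gram. Qed.

Lemma proj_gram_ge0 W x : 0 <= bform (proj_gram W) x x.
Proof.
by rewrite bform_proj_gram; apply: sumr_ge0 => i _; rewrite -expr2 sqr_ge0.
Qed.

Variables (m : nat) (W : 'I_m -> {vspace 'rV[R]_n}).

Hypothesis noxy : ~ exists x y, [/\ x <> y, x <> - y &
  forall j, enorm (oproj (W j) x) = enorm (oproj (W j) y)].

(** The forms at (x + y, x + y) and (x - y, x - y) differ by four times their
    value at (x, y), so a common zero (x, y) would give two vectors with equal
    projections.  For x = y it says that no nonzero vector is orthogonal to all
    the subspaces. *)
Lemma retrieval_pair_definite x y : x != 0 -> y != 0 ->
  exists j, bform (proj_gram (W j)) x y != 0.
Proof.
move=> x0 y0; apply: contrapT => no_j; apply: noxy.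
exists (x + y), (x - y); split=> [|| j].
- move/addrI/eqP; rewrite -addr_eq0 -mulr2n -scaler_nat scaler_eq0 (negPf y0).
  by rewrite pnatr_eq0.
- rewrite opprB addrC => /addrI/eqP; rewrite -addr_eq0 -mulr2n -scaler_nat.
  by rewrite scaler_eq0 (negPf x0) pnatr_eq0.
rewrite !enorm_oproj; congr Num.sqrt.
have Bxy : bform (proj_gram (W j)) x y = 0.
  by apply: contrapT => /eqP Bj; apply: no_j; exists j.
rewrite -scaleN1r !bformDl !bformDr !bformZl !bformZr.
by rewrite (bformC y x (proj_gramT _)) Bxy; ring.
Qed.

End Projections.

(** Without such x and y, the forms of the projections, completed by zero forms
    to a family of 2q, would contradict no_points_far at the points supplied by
    deformed_real_points. *)
Theorem corollary4p1 (R : realType) (n k m : nat)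
    (hk : (1 <= k)%N) (hn : n = (2 ^ k + 1)%N)
    (hm : (m < 2 * n - 1)%N)
    (W : 'I_m -> {vspace 'rV[R]_n}) :
  exists x y : 'rV[R]_n,
    [/\ x <> y, x <> - y &
        forall j : 'I_m, enorm (oproj (W j) x) = enorm (oproj (W j) y)].
Proof.
rewrite addn1 in hn; move: W; rewrite {n}hn in hm * => W.
have [D oddD binD] := odd_bin_central k; set q := (2 ^ k)%N in hm W binD *.
have q0 : (0 < q)%N by rewrite expn_gt0.
have le_mq : (m <= q + q)%N.
  by move: hm; rewrite mul2n -addnn addSn subn1 /= addnS ltnS.
apply: boolp.contrapT => noxy.
pose B (i : 'I_(q + q)) : 'M[R]_q.+1 :=
  if insub (val i) is Some j then proj_gram (W j) else 0.
have BE j : B (widen_ord le_mq j) = proj_gram (W j).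
  rewrite /B /= insubT // => lt; congr (proj_gram (W _)); exact: val_inj.
have symB i : (B i)^T = B i.
  by rewrite /B; case: insub => [j|]; [exact: proj_gramT | exact: trmx0].
have symE i : (coefform R q i)^T = coefform R q i.
  by apply/matrixP => a b; rewrite !mxE addnC.
have [t points] := deformed_real_points symB q0 binD oddD.
have [||S far] := @no_points_far R q _ B (fun i => coefform R q i) t symB symE.
- move=> x y x0 y0; have [j Bj] := retrieval_pair_definite noxy x0 y0.
  by exists (widen_ord le_mq j); rewrite BE.
- move=> x x0; have [j Bj] := retrieval_pair_definite noxy x0 x0.
  rewrite bform_sum (bigD1 (widen_ord le_mq j)) //= BE ltr_wpDr //.
    apply: sumr_ge0 => i _; rewrite /B; case: insub => [j'|].
      exact: proj_gram_ge0.
    by rewrite /bform mulmx0 mul0mx mxE.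
  by rewrite lt0r Bj proj_gram_ge0.
have [s [w [a [c [leSs a1 c0 eqt]]]]] := points S.
exact: far leSs a1 c0 eqt.
Qed.
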